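(* Let $\mathscr{H}$ be a real Hilbert space, let $A:\mathscr{H}\to 2^{\mathscr{H}}$ be maximal monotone and $\nu$-strongly monotone for some $\nu>0$, and let $B:\mathscr{H}\to\mathscr{H}$ be monotone and $L$-Lipschitz continuous for some $L>0$. Put $\Omega:=\{x\in\mathscr{H}:\mathbf{0}\in A(x)+B(x)\}$. Let $\gamma\in(0,2)$, $\mu\in(0,1)$, $\lambda_1>0$, $0<\alpha<\tfrac13$, and $$\tau:=1-\frac14\min\left\{\frac{(2\gamma-\gamma^2)(1-\mu)^2}{(1+\mu)^2},\ 2\nu\gamma\,\frac{1-\mu}{(1+\mu)^2}\min\left\{\lambda_1,\frac{\mu}{L}\right\}\right\},$$ and let $\theta$ satisfy $0\le\theta<\frac1\tau-1$. Then any sequence $\{x_n\}$ generated by Algorithm IPCMAS2 (described in the context) with these parameters converges strongly to the unique point $x^\ast$ of $\Omega$ with an R-linear convergence rate; that is, there exist $c>0$ and $\rho\in[0,1)$ such that $\|x_n-x^\ast\|\le c\,\rho^n$ for all $n$.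
   Context: A set-valued operator $A:\mathscr{H}\to2^{\mathscr{H}}$ is $\nu$-strongly monotone ($\nu>0$) if $\langle u-v,x-y\rangle\ge\nu\|x-y\|^2$ for all $x,y\in\mathscr{H}$, $u\in A(x)$, $v\in A(y)$. For $\lambda>0$, the resolvent of a maximal monotone operator $A$ is the single-valued map $J^A_\lambda:=(I+\lambda A)^{-1}:\mathscr{H}\to\mathscr{H}$. Algorithm IPCMAS2. Given $\gamma,\mu,\lambda_1,\alpha,\theta$, a nonnegative real sequence $\{\xi_n\}_{n\ge1}$ with $\sum_{n=1}^\infty\xi_n<+\infty$, and arbitrary starting points $x_0,x_1\in\mathscr{H}$. For $n=1,2,\dots$ compute $$w_n=x_n+\theta(x_n-x_{n-1}),\qquad y_n=J^A_{\lambda_n}\big(w_n-\lambda_nB(w_n)\big).$$ If $y_n=w_n$, stop ($y_n\in\Omega$). Otherwise set $$d_n=w_n-y_n-\lambda_n\big(B(w_n)-B(y_n)\big),\qquad \eta_n=\begin{cases}\dfrac{\langle w_n-y_n,d_n\rangle}{\|d_n\|^2},&d_n\neq0,\\ 0,&d_n=0,\end{cases}$$ $$u_n=w_n-\gamma\eta_nd_n,\qquad x_{n+1}=(1-\alpha)x_n+\alpha u_n,$$ and update $$\lambda_{n+1}=\begin{cases}\min\left\{\dfrac{\mu\|w_n-y_n\|}{\|B(w_n)-B(y_n)\|},\ \lambda_n+\xi_n\right\},&B(w_n)\neq B(y_n),\\ \lambda_n+\xi_n,&\text{otherwise.}\end{cases}$$ Statements about the generated sequence $\{x_n\}$ concern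 infinite runs, i.e. the case in which the algorithm never stops ($y_n\ne w_n$ for all $n\ge1$). *)

(* Defs.v *)
From mathcomp Require Import all_boot all_order all_algebra.
From mathcomp Require Import all_classical all_reals all_analysis.
Import Order.TTheory GRing.Theory Num.Theory.
Import numFieldNormedType.Exports.

Set Implicit Arguments.
Unset Strict Implicit.
Unset Printing Implicit Defensive.

Local Open Scope classical_set_scope.
Local Open Scope ring_scope.

(** A real Hilbert space is a [completeNormedModType] over a [realType] with an
    inner product inducing its norm.  [idfun] is the conjugation of the real
    scalars, so [{dot H for idfun}] is the type of symmetric, positive definite
    bilinear forms. *)
Definition induces_norm (R : realType) (H : completeNormedModType R)
    (dot : {dot H for idfun}) : Prop :=
  forall x : H, `|x| ^+ 2 = dot x x.

Section Operators.
Context (R : realType) (H : completeNormedModType R) (dot : {dot H for idfun}).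
Implicit Types (A : H -> set H) (B : H -> H).

Definition monotone_op A : Prop :=
  forall x y u v, A x u -> A y v -> 0 <= dot (u - v) (x - y).

Definition maximal_monotone A : Prop :=
  monotone_op A /\
  forall A', monotone_op A' -> (forall x, A x `<=` A' x) ->
    forall x, A' x `<=` A x.

Definition strongly_monotone (nu : R) A : Prop :=
  forall x y u v, A x u -> A y v -> nu * `|x - y| ^+ 2 <= dot (u - v) (x - y).

(** The points [y] with [z \in y + lam * A y]. *)
Definition resolvent_set A (lam : R) (z : H) : set H :=
  [set y | [set y + lam *: u | u in A y] z].

(** [resolvent_set A lam z] is a singleton when [A] is maximal monotone and
    [0 < lam]; the default value [0] is used only outside that case. *)
Definition resolvent A (lam : R) (z : H) : H := xget 0 (resolvent_set A lam z).

Definition zeros_of_sum A B : set H := [set x | [set u + B x | u in A x] 0].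

End Operators.

(** An infinite run.  All sequences are indexed from 1, except [x], which also
    has a term [x 0]; the values of the others at 0 are irrelevant. *)
Record IPCMAS2_run (R : realType) (H : completeNormedModType R)
    (dot : {dot H for idfun}) (A : H -> set H) (B : H -> H)
    (gamma mu lam1 alpha theta : R) (xi : nat -> R)
    (x w y d u : nat -> H) (eta lam : nat -> R) : Prop := {
  run_lam1 : lam 1%N = lam1 ;
  run_w : forall n, (0 < n)%N -> w n = x n + theta *: (x n - x n.-1) ;
  run_y : forall n, (0 < n)%N ->
    y n = resolvent A (lam n) (w n - lam n *: B (w n)) ;
  run_continues : forall n, (0 < n)%N -> y n <> w n ;
  run_d : forall n, (0 < n)%N ->
    d n = w n - y n - lam n *: (B (w n) - B (y n)) ;
  run_eta : forall n, (0 < n)%N ->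
    eta n = if d n != 0 then dot (w n - y n) (d n) / `|d n| ^+ 2 else 0 ;
  run_u : forall n, (0 < n)%N -> u n = w n - (gamma * eta n) *: d n ;
  run_x : forall n, (0 < n)%N ->
    x n.+1 = (1 - alpha) *: x n + alpha *: u n ;
  run_lam : forall n, (0 < n)%N ->
    lam n.+1 = if B (w n) != B (y n)
               then Num.min (mu * `|w n - y n| / `|B (w n) - B (y n)|)
                            (lam n + xi n)
               else lam n + xi n }.

Definition tau_rate (R : realType) (gamma mu nu L lam1 : R) : R :=
  1 - 4^-1 * Num.min
    ((2 * gamma - gamma ^+ 2) * (1 - mu) ^+ 2 / (1 + mu) ^+ 2)
    (2 * nu * gamma * ((1 - mu) / (1 + mu) ^+ 2) * Num.min lam1 (mu / L)).

(* Main.v *)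
Require Import Defs.
From mathcomp Require Import all_boot all_order all_algebra.
From mathcomp Require Import all_classical all_reals all_analysis.
From mathcomp Require Import ring lra.
Import Order.TTheory GRing.Theory Num.Theory.
Import numFieldNormedType.Exports.

(** The resolvents exist by Minty's theorem, obtained by minimising the
    Fitzpatrick function plus [(|x|^2 + |s|^2) / 2]: the parallelogram identity
    makes a minimising sequence Cauchy, so no weak compactness is needed.  For
    small [lam] the map [x |-> J_lam (x - lam B x)] is a contraction, and its
    fixed point is the zero [p] of [A + B].

    Summability of [xi] makes [lam n] converge to a positive limit, so eventually
    [lam n |B w - B y| <= m |w - y|] for any fixed [m > mu].  For [m] close to
    [mu] the relaxed projection step then gives [|u - p|^2 <= tau |w - p|^2], and
    [|x_n - p|^2 + (1 - alpha) / alpha |x_n - x_(n-1)|^2] contracts by the factor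
    [1 - alpha (1 - tau (1 + theta))]. *)

Set Implicit Arguments.
Unset Strict Implicit.
Unset Printing Implicit Defensive.

Local Open Scope classical_set_scope.
Local Open Scope ring_scope.

(** * Two elementary tools for minimisation: a Cauchy criterion and a first-order condition *)

Lemma cvg_harmonic_sq_dist (R : realType) (V : completeNormedModType R)
    (x : nat -> V) (C : R) :
  (forall n k, `|x n - x k| ^+ 2 <= C * (n.+1%:R^-1 + k.+1%:R^-1)) ->
  cvgn x.
Proof.
move=> xC; apply/cauchy_cvgP; apply/cauchy_ballP => e e0.
have C0 : 0 <= C.
  by have := le_trans (sqr_ge0 _) (xC 0 0)%N; rewrite invr1 pmulr_lge0.
have [N [_ HN]] : exists N, [set N : nat | C * (2 * N.+1%:R^-1) < e ^+ 2] N /\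
    forall n : nat, (N <= n)%N -> C * (2 * n.+1%:R^-1) < e ^+ 2.
  have : C * (2 * n.+1%:R^-1) @[n --> \oo] --> C * (2 * (0:R)).
    by apply: cvgMr; apply: cvgMr; exact: cvg_harmonic.
  rewrite !mulr0 => /cvgrPdist_lt /(_ _ (exprn_gt0 2 e0)) [N _ HN].
  have H n : (N <= n)%N -> C * (2 * n.+1%:R^-1) < e ^+ 2.
    move=> Nn; apply: le_lt_trans (HN n Nn).
    by rewrite sub0r normrN ler_norm.
  by exists N; split => //=; exact: H.
exists (x @` [set n | (N <= n)%N], x @` [set n | (N <= n)%N]) => /=.
  by split; exists N => // n /= Nn; exists n.
move=> [_ _] [/= [n Nn <-] [k Nk <-]].
rewrite -ball_normE /= -(@ltr_pXn2r _ 2) ?nnegrE ?(ltW e0) //.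
apply: le_lt_trans (xC n k) _.
move: (HN n Nn) (HN k Nk); rewrite mulrDr ![C * (2 * _)]mulrCA.
by set a := C * _; set b := C * _; lra.
Qed.

(** First-order optimality: the right derivative at a minimiser is nonnegative. *)
Lemma linear_coef_ge0 (R : realFieldType) (a b : R) :
  (forall c, 0 < c <= 1 -> 0 <= c * a + c ^+ 2 * b) -> 0 <= a.
Proof.
move=> H; rewrite leNgt; apply/negP => a0.
have D0 : 0 < `|b| - a by have := normr_ge0 b; lra.
(* This [c] lies in (0, 1], and [c * b < - a] because [|b| < |b| - a]; hence [a + c * b < 0]. *)
have := H (- a / (`|b| - a)).
rewrite divr_gt0 ?oppr_gt0 // ler_pdivrMr // mul1r => /(_ _).
have -> : - a <= `|b| - a by have := normr_ge0 b; lra.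
move=> /(_ isT); apply/negP; rewrite -ltNge.
rewrite expr2 -mulrA -mulrDr pmulr_rlt0 ?divr_gt0 ?oppr_gt0 //.
rewrite -(pmulr_llt0 _ D0) mulrDl mulrAC divfK ?gt_eqF //.
have := ler_norm b; nra.
Qed.

(** * Inner product calculus *)

Section InnerProduct.
Context (R : realType) (H : completeNormedModType R) (dot : {dot H for idfun}).
Implicit Types x y z : H.

Lemma dotC x y : dot x y = dot y x.
Proof. by rewrite hermC expr0 mul1r. Qed.

Lemma dotDl x y z : dot (x + y) z = dot x z + dot y z.
Proof. exact: linearDl. Qed.

Lemma dotDr x y z : dot z (x + y) = dot z x + dot z y.
Proof. exact: linearDr. Qed.

Lemma dotNl x z : dot (- x) z = - dot x z.
Proof. exact: linearNl. Qed.

Lemma dotNr x z : dot z (- x) = - dot z x.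
Proof. exact: linearNr. Qed.

Lemma dotZl a x z : dot (a *: x) z = a * dot x z.
Proof. exact: linearZl_LR. Qed.

Lemma dotZr a x z : dot z (a *: x) = a * dot z x.
Proof. by rewrite dotC dotZl dotC. Qed.

Definition dotE := (dotDl, dotDr, dotNl, dotNr, dotZl, dotZr).

Hypothesis dot_norm : induces_norm dot.

Lemma dot_cauchy_schwarz x y : `|dot x y| <= `|x| * `|y|.
Proof.
have [xy0|xy0] := leP (`|x| * `|y|) 0.
  have : `|x| * `|y| == 0 by rewrite eq_le xy0 mulr_ge0.
  rewrite mulf_eq0 !normr_eq0 => /orP[] /eqP ->.
    by rewrite -[X in dot X _](scale0r 0) dotZl mul0r normr0 mulr_ge0.
  by rewrite -[X in dot _ X](scale0r 0) dotZr mul0r normr0 mulr_ge0.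
(* Expanded and divided by [2 |x| |y|], [Hp] gives the lower bound on [dot x y] and [Hm] the upper
   one. *)
have Hp := sqr_ge0 `| `|x| *: y + `|y| *: x |.
have Hm := sqr_ge0 `| `|x| *: y - `|y| *: x |.
move: Hp Hm; rewrite !dot_norm !dotE -!dot_norm (dotC y x) => Hp Hm.
rewrite ler_norml; apply/andP; split; rewrite -(ler_pM2l xy0); lra.
Qed.

Lemma cvg_dotl (f : nat -> H) x y : f @ \oo --> x ->
  dot (f n) y @[n --> \oo] --> dot x y.
Proof.
move=> fx; apply/cvgrPdist_lt => e e0.
have e0' : 0 < e / (`|y| + 1) by rewrite divr_gt0 // ltr_wpDl.
move/cvgrPdist_lt : fx => /(_ _ e0'); apply: filterS => n.
rewrite ltr_pdivlMr ?ltr_wpDl // => fxe.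
rewrite -dotNl -dotDl; apply: le_lt_trans (dot_cauchy_schwarz _ _) _.
by apply: le_lt_trans fxe; rewrite ler_wpM2l // lerDl.
Qed.

Lemma sqr_norm_convex (X U : H) a :
  `|(1 - a) *: X + a *: U| ^+ 2 =
  (1 - a) * `|X| ^+ 2 + a * `|U| ^+ 2 - a * (1 - a) * `|X - U| ^+ 2.
Proof. by rewrite !dot_norm !dotE (dotC U X); ring. Qed.

Lemma sqr_norm_subZ (X Y : H) t :
  `|X - t *: Y| ^+ 2 = `|X| ^+ 2 - 2 * t * dot Y X + t ^+ 2 * `|Y| ^+ 2.
Proof. by rewrite !dot_norm !dotE (dotC X Y); ring. Qed.

(** The convexity identity with weight [- t]: for [t > 0] the point lies beyond [X], so the last
    term changes sign. *)
Lemma sqr_norm_extrapolation (X Y : H) t :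
  `|X + t *: (X - Y)| ^+ 2 =
  (1 + t) * `|X| ^+ 2 - t * `|Y| ^+ 2 + t * (1 + t) * `|X - Y| ^+ 2.
Proof. by rewrite !dot_norm !dotE (dotC Y X); ring. Qed.

End InnerProduct.

(** * Maximal monotone operators, Minty's theorem and resolvents *)

(** A pair monotonically related to the whole graph can be added to it without losing monotonicity,
    so maximality already contains it. *)
Lemma maximal_monotoneP (R : realType) (H : completeNormedModType R)
    (dot : {dot H for idfun}) (A : H -> set H) :
  maximal_monotone dot A <->
  monotone_op dot A /\ forall x u,
    (forall y v, A y v -> 0 <= dot (u - v) (x - y)) -> A x u.
Proof.
split=> [[mono maxi]|[mono maxi]]; split=> //.
  move=> x u xu.
  apply: (maxi (fun y => [set v | A y v \/ (y = x /\ v = u)])) => /=.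
  - move=> y z v w /= [Ayv|[-> ->]] [Azw|[-> ->]].
    + exact: mono.
    + by rewrite -opprB dotNl -[y - x]opprB dotNr opprK; exact: xu.
    + exact: xu.
    + by rewrite !subrr -[X in dot X _](scale0r 0) dotZl mul0r.
  - by move=> y v /= Ayv; left.
  - by right.
move=> A' mono' AA' x u A'xu; apply: maxi => y v Ayv.
by apply: mono' => //; exact: AA'.
Qed.

Section Minty.
Context (R : realType) (H : completeNormedModType R) (dot : {dot H for idfun}).
Hypothesis dot_norm : induces_norm dot.
Context (M : H -> set H) (M_max : maximal_monotone dot M).
Implicit Types (x s y v : H) (t : R).

(* The Fitzpatrick function of M may take the value +oo, so it is represented
   by its epigraph. *)
Definition fitzpatrick_epi x s t : Prop :=
  forall y v, M y v -> dot x v + dot y s - dot y v <= t.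

(** If [t < dot x s], the epigraph inequalities make [(x, s)] monotonically related to the graph,
    hence a point of it; the inequality at that very point then gives [dot x s <= t]. *)
Lemma fitzpatrick_epi_ge x s t : fitzpatrick_epi x s t -> dot x s <= t.
Proof.
move=> E; rewrite leNgt; apply/negP => t_lt.
have /maximal_monotoneP[_ maxi] := M_max.
have : M x s.
  apply: maxi => y v Myv; have := E _ _ Myv.
  by rewrite !dotE (dotC dot s x) (dotC dot s y) (dotC dot v x) (dotC dot v y); lra.
by move/E; lra.
Qed.

Lemma fitzpatrick_epi_graph y v : M y v -> fitzpatrick_epi y v (dot y v).
Proof.
move=> Myv z w Mzw; have [mono _] := M_max.
have := mono _ _ _ _ Myv Mzw.
by rewrite !dotE (dotC dot v y) (dotC dot v z) (dotC dot w y) (dotC dot w z); lra.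
Qed.

Lemma fitzpatrick_epi_convex x s t x' s' t' c : 0 <= c <= 1 ->
  fitzpatrick_epi x s t -> fitzpatrick_epi x' s' t' ->
  fitzpatrick_epi (x + c *: (x' - x)) (s + c *: (s' - s)) (t + c * (t' - t)).
Proof.
move=> /andP[c0 c1] E E' y v Myv.
have := E _ _ Myv; have := E' _ _ Myv; rewrite !dotE.
set a := dot x v; set b := dot y s; set a' := dot x' v; set b' := dot y s'.
nra.
Qed.

Let q x s : R := (`|x| ^+ 2 + `|s| ^+ 2) / 2.

(** The parallelogram identity; the subtracted term is the strong convexity that makes minimising
    sequences Cauchy. *)
Let q_mid x s x' s' : q (x + 2^-1 *: (x' - x)) (s + 2^-1 *: (s' - s)) =
  (q x s + q x' s') / 2 - (`|x - x'| ^+ 2 + `|s - s'| ^+ 2) / 8.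
Proof.
rewrite /q !dot_norm !dotE (dotC dot x' x) (dotC dot s' s).
by field.
Qed.

Let q_line x s x' s' c : q (x + c *: (x' - x)) (s + c *: (s' - s)) =
  q x s + c * (dot x (x' - x) + dot s (s' - s)) + c ^+ 2 * q (x' - x) (s' - s).
Proof.
rewrite /q !dot_norm !dotE (dotC dot x' x) (dotC dot s' s).
by field.
Qed.

Lemma fitzpatrick_min : exists x s t, fitzpatrick_epi x s t /\
  forall x' s' t', fitzpatrick_epi x' s' t' -> t + q x s <= t' + q x' s'.
Proof.
pose S := [set r : R | exists x s t, fitzpatrick_epi x s t /\ r = t + q x s].
(* [t >= dot x s], and [dot x s + q x s] is half of [|x + s|^2]. *)
have S_lb : lbound S 0.
  move=> _ [x [s [t [E ->]]]]; have := fitzpatrick_epi_ge E.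
  have := sqr_ge0 `|x + s|; rewrite /q !dot_norm !dotE (dotC dot s x); lra.
(* With an empty graph every pair would be monotonically related to it, and maximality would put
   [(0, 0)] in it. *)
have [y0 [v0 Myv0]] : exists y v, M y v.
  apply/not_existsP => M0; have /maximal_monotoneP[_ maxi] := M_max.
  apply: (M0 0); exists 0; apply: maxi => y v Myv.
  by exfalso; apply: (M0 y); exists v.
have S_inf : has_inf S.
  split; last by exists 0.
  by exists (dot y0 v0 + q y0 v0), y0, v0, (dot y0 v0); split=> //;
    exact: fitzpatrick_epi_graph.
set m := inf S.
have mE x s t : fitzpatrick_epi x s t -> m <= t + q x s.
  by move=> E; apply: ge_inf; [exists 0|exists x, s, t].
have /choice[p Hp] : forall n : nat, exists p : H * H * R,
    fitzpatrick_epi p.1.1 p.1.2 p.2 /\ p.2 + q p.1.1 p.1.2 < m + n.+1%:R^-1.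
  move=> n; have n0 : 0 < n.+1%:R^-1 :> R by rewrite invr_gt0.
  have [_ [x [s [t [E ->]]]] lt_m] := inf_adherent n0 S_inf.
  by exists (x, s, t).
pose xs n := (p n).1.1; pose ss n := (p n).1.2.
(* The value at the midpoint is at least [m], while both ends exceed [m] by less than [1/(n+1)] and
   [1/(k+1)]; [q_mid] turns this gap into a bound on the distance. *)
have sqD n k : `|xs n - xs k| ^+ 2 + `|ss n - ss k| ^+ 2 <=
    4 * (n.+1%:R^-1 + k.+1%:R^-1).
  have [En ln] := Hp n; have [Ek lk] := Hp k.
  have h : 0 <= (2^-1 : R) <= 1 by apply/andP; split; lra.
  have := mE _ _ _ (fitzpatrick_epi_convex h En Ek); rewrite q_mid.
  move: ln lk; rewrite -/(xs n) -/(xs k) -/(ss n) -/(ss k).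
  set a := n.+1%:R^-1; set b := k.+1%:R^-1; lra.
have /cvg_ex[/= x xsx] : cvgn xs.
  apply: (@cvg_harmonic_sq_dist _ _ _ 4) => n k; apply: le_trans (sqD n k).
  by rewrite lerDl sqr_ge0.
have /cvg_ex[/= s sss] : cvgn ss.
  apply: (@cvg_harmonic_sq_dist _ _ _ 4) => n k; apply: le_trans (sqD n k).
  by rewrite lerDr sqr_ge0.
exists x, s, (m - q x s); split; last first.
  by move=> x' s' t' /mE; lra.
move=> y v Myv.
(* [r n] bounds the height of the n-th epigraph point from above and tends to [m - q x s], so each
   affine inequality passes to the limit. *)
pose r n : R := m + n.+1%:R^-1 - q (xs n) (ss n).
have rl : r n @[n --> \oo] --> m - q x s.
  have -> : m - q x s = m + 0 - q x s by rewrite addr0.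
  apply: cvgB.
    by apply: cvgD; [exact: cvg_cst|exact: cvg_harmonic].
  apply: cvgMl; apply: cvgD; rewrite expr2.
    by under eq_fun do rewrite expr2; apply: cvgM; exact: cvg_norm.
  by under eq_fun do rewrite expr2; apply: cvgM; exact: cvg_norm.
have fl : dot (xs n) v + dot (ss n) y - dot y v @[n --> \oo] -->
    dot x v + dot s y - dot y v.
  by apply: cvgB; [apply: cvgD; exact: cvg_dotl|exact: cvg_cst].
rewrite (dotC dot y s); apply: ler_cvg_to fl rl _.
apply: nearW => n; have [En ln] := Hp n.
have := En _ _ Myv; rewrite (dotC dot y (ss n)) /r -/(xs n) -/(ss n).
by move: ln; rewrite -/(xs n) -/(ss n); set a := _^-1; lra.
Qed.

(* A minimiser (x, s) of the Fitzpatrick function plus half the squared norm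
   makes (-s, -x) monotonically related to the graph of M, and then s = -x. *)
Lemma minty_zero : exists x, M x (- x).
Proof.
have [x [s [t [E tmin]]]] := fitzpatrick_min.
have ts := fitzpatrick_epi_ge E.
(* Optimality along the segment from the minimiser to the graph point [(y, v)] at height
   [dot y v]. *)
have opt y v : M y v -> 0 <= dot y v - t + (dot x (y - x) + dot s (v - s)).
  move=> /fitzpatrick_epi_graph E'.
  apply: (@linear_coef_ge0 _ _ (q (y - x) (v - s))) => c /andP[c0 c1].
  have c01 : 0 <= c <= 1 by rewrite ltW.
  have := tmin _ _ _ (fitzpatrick_epi_convex c01 E E').
  by rewrite q_line; lra.
have key y v : M y v -> `|x + s| ^+ 2 <= dot (v + x) (y + s).
  move=> /opt; rewrite !dot_norm !dotE (dotC dot s x) (dotC dot v y) (dotC dot v s).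
  lra.
have Msx : M (- s) (- x).
  have /maximal_monotoneP[_ maxi] := M_max; apply: maxi => y v /key le0.
  by rewrite -!opprD dotNl dotNr opprK addrC (addrC s) (le_trans _ le0) ?sqr_ge0.
have := key _ _ Msx; rewrite addNr -[X in dot X _](scale0r 0) dotZl mul0r.
rewrite exprn_even_le0 //= normr_eq0 addr_eq0 => /eqP xs.
by move: Msx; rewrite -xs; exists x.
Qed.

End Minty.

Lemma resolventP (R : realType) (H : completeNormedModType R)
    (dot : {dot H for idfun}) (dot_norm : induces_norm dot)
    (A : H -> set H) (A_max : maximal_monotone dot A) (lam : R) (z : H) :
  0 < lam -> resolvent_set A lam z (resolvent A lam z).
Proof.
move=> lam0; apply: xgetPex.
have /maximal_monotoneP[mono maxi] := A_max.
(* [M] is [lam A - z], again maximal monotone; [- y] in [M y] says that [z] lies in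
   [y + lam A y]. *)
pose M (y : H) := [set v : H | A y (lam^-1 *: (v + z))].
have [y My] : exists y, M y (- y).
  apply: (minty_zero dot_norm); apply/maximal_monotoneP; split.
    move=> x y u v /= Axu Ayv; have := mono _ _ _ _ Axu Ayv.
    by rewrite -scalerBr opprD addrACA subrr addr0 dotZl pmulr_rge0 ?invr_gt0.
  move=> x u xu; apply: maxi => y v Ayv.
  have := xu y (lam *: v - z).
  rewrite /M /= subrK scalerA mulVf ?gt_eqF // scale1r => /(_ Ayv).
  have -> : lam^-1 *: (u + z) - v = lam^-1 *: (u - (lam *: v - z)).
    by rewrite opprB addrA scalerBr scalerA mulVf ?gt_eqF // scale1r.
  by rewrite dotZl pmulr_rge0 ?invr_gt0.
exists y, (lam^-1 *: (- y + z)) => //.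
by rewrite scalerA mulfV ?gt_eqF // scale1r addNKr.
Qed.

(** * Existence and uniqueness of the zero of [A + B] *)

Section Zero.
Context (R : realType) (H : completeNormedModType R) (dot : {dot H for idfun}).
Hypothesis dot_norm : induces_norm dot.
Context (A : H -> set H) (B : H -> H) (nu L : R).
Hypotheses (A_max : maximal_monotone dot A) (nu_gt0 : 0 < nu).
Hypothesis A_strong : strongly_monotone dot nu A.
Hypothesis B_mono : monotone_op dot (fun x => [set B x]).
Hypotheses (L_gt0 : 0 < L) (B_lip : L.-lipschitz B).

Lemma lipschitz_le x y : `|B x - B y| <= L * `|x - y|.
Proof. exact: (B_lip (x := (x, y))). Qed.

Lemma monotone_ge0 x y : 0 <= dot (B x - B y) (x - y).
Proof. exact: B_mono. Qed.

(** Strong monotonicity bounds [(1 + lam nu) |y - y'|^2] by the inner product of [z - z'] and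
    [y - y']; Cauchy-Schwarz finishes. *)
Lemma resolvent_strongly_monotone lam z z' : 0 < lam ->
  (1 + lam * nu) * `|resolvent A lam z - resolvent A lam z'| <= `|z - z'|.
Proof.
move=> lam0.
have [u Au zE] := resolventP dot_norm A_max z lam0.
have [u' Au' zE'] := resolventP dot_norm A_max z' lam0.
move: (resolvent A lam z) (resolvent A lam z') Au Au' zE zE' => y y' Au Au' <- <-.
have := A_strong Au Au' => mono.
have [->|yy'] := eqVneq y y'; first by rewrite subrr normr0 mulr0.
rewrite -(ler_pM2r (_ : 0 < `|y - y'|)) ?normr_gt0 ?subr_eq0 //.
apply: le_trans (le_trans (ler_norm _) (dot_cauchy_schwarz dot_norm _ _)).
rewrite -mulrA -expr2 opprD addrACA -scalerBr dotDl dotZl -dot_norm mulrDl mul1r.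
by rewrite lerD2l -mulrA ler_wpM2l // ltW.
Qed.

Lemma zeros_of_sum_unique : exists p, zeros_of_sum A B = [set p].
Proof.
(* With this choice [lam nu = lam^2 L^2]: the forward step expands squared distances by at most
   [1 + lam nu], the resolvent shrinks them by [(1 + lam nu)^2], and [k^2] is the quotient. *)
pose lam := nu / L ^+ 2.
have lam0 : 0 < lam by rewrite divr_gt0 // exprn_gt0.
have lnu0 : 0 < lam * nu by rewrite mulr_gt0.
have D0 : 0 < 1 + lam * nu by rewrite addr_gt0.
pose T z := resolvent A lam (z - lam *: B z).
pose k := Num.sqrt (1 + lam * nu)^-1.
have T_lip z z' : `|T z - T z'| <= k * `|z - z'|.
  have := resolvent_strongly_monotone (z - lam *: B z) (z' - lam *: B z') lam0.
  rewrite -/(T z) -/(T z') => le1.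
  rewrite -(@ler_pXn2r _ 2) ?nnegrE ?mulr_ge0 ?sqrtr_ge0 //.
  rewrite exprMn sqr_sqrtr ?invr_ge0 ?(ltW D0) //.
  rewrite ler_pdivlMl // -(ler_pM2l D0).
  rewrite mulrA -expr2 -exprMn.
  apply: (@le_trans _ _ (`|z - lam *: B z - (z' - lam *: B z')| ^+ 2)).
    by rewrite ler_pXn2r ?nnegrE ?mulr_ge0 ?(ltW D0).
  have -> : z - lam *: B z - (z' - lam *: B z') = (z - z') - lam *: (B z - B z').
    by rewrite scalerBr !opprD !opprK addrACA.
  have := monotone_ge0 z z'.
  have : `|B z - B z'| ^+ 2 <= (L * `|z - z'|) ^+ 2.
    by rewrite ler_pXn2r ?nnegrE ?mulr_ge0 ?lipschitz_le // ltW.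
  move: (z - z') (B z - B z') => e f; rewrite exprMn => lef ef.
  rewrite dot_norm !dotE -!dot_norm (dotC dot e f) opprK mulrDl mul1r.
  have -> : lam * nu = lam ^+ 2 * L ^+ 2 by rewrite /lam; field; rewrite gt_eqF.
  have : lam ^+ 2 * `|f| ^+ 2 <= lam ^+ 2 * (L ^+ 2 * `|e| ^+ 2).
    by rewrite ler_wpM2l // sqr_ge0.
  have : 0 <= lam * dot f e by rewrite mulr_ge0 // ltW.
  by nra.
have k1 : k < 1.
  rewrite -sqrtr1 ltr_sqrt // invf_lt1 //; lra.
have [p _ pE] : exists2 p, setT p & p = T p.
  have Tfun : set_fun setT setT T by [].
  pose f : {fun [set: H] >-> [set: H]} := mkfun Tfun.
  apply: (@banach_fixed_point _ _ _ f) => //; last by exists 0.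
  by exists (NngNum (sqrtr_ge0 _ : 0 <= k)); split=> // -[x y] _; exact: T_lip.
exists p; have zp : zeros_of_sum A B p.
  have [u Au] := resolventP dot_norm A_max (p - lam *: B p) lam0.
  rewrite -/(T p) -pE => /addrI; rewrite -scalerN => /scalerI uE.
  exists u; first by move: Au; rewrite -/(T p) -pE.
  by rewrite uE ?addNr // gt_eqF.
apply/seteqP; split=> [x [u Au]|_ -> //]; have [v Av] := zp.
move=> /eqP; rewrite addr_eq0 => /eqP vE /eqP; rewrite addr_eq0 => /eqP uE.
have := A_strong Au Av; rewrite uE vE -opprD dotNl => le0.
have := monotone_ge0 x p => ge0.
have : nu * `|x - p| ^+ 2 <= 0 by lra.
by rewrite pmulr_rle0 // exprn_even_le0 //= normr_eq0 subr_eq0 => /eqP.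
Qed.

End Zero.

(** * Real sequences and numerical constants *)

(** Subtracting the partial sums of [xi] leaves a nonincreasing sequence that is bounded below. *)
Lemma quasi_nonincreasing_cvg (R : realType) (a xi : nat -> R) (c : R) :
  (forall n, (0 < n)%N -> 0 <= xi n) ->
  (\sum_(1 <= n <oo) (xi n)%:E < +oo)%E ->
  (forall n, (0 < n)%N -> a n.+1 <= a n + xi n) ->
  (forall n, (0 < n)%N -> c <= a n) ->
  cvgn a.
Proof.
move=> xi0 xi_sum aS c_le.
pose S n := \sum_(1 <= k < n.+1) xi k.
have SS n : S n.+1 = S n + xi n.+1 by rewrite /S big_nat_recr.
have xi0' n : (1 <= n)%N -> xpredT n -> (0 <= (xi n)%:E)%E.
  by move=> n1 _; rewrite lee_fin xi0.
have sum_fin : (\sum_(1 <= n <oo) (xi n)%:E)%E \is a fin_num.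
  by rewrite ge0_fin_numE // nneseries_ge0.
have S_le n : S n <= fine (\sum_(1 <= n <oo) (xi n)%:E)%E.
  rewrite -lee_fin fineK // /S -sumEFin.
  exact: (nneseries_lim_ge n.+1 xi0').
have S_cvg : cvgn S.
  apply: nondecreasing_is_cvgn; first by apply/nondecreasing_seqP => n;
    rewrite SS lerDl xi0.
  by eexists => _ [n _ <-]; exact: S_le.
(* The shift avoids [a 0], about which nothing is assumed. *)
pose b n := a n.+1 - S n.
have b_cvg : cvgn b.
  apply: nonincreasing_is_cvgn.
    apply/nonincreasing_seqP => n; rewrite /b SS.
    by have := aS n.+1 (ltn0Sn n); lra.
  exists (c - fine (\sum_(1 <= n <oo) (xi n)%:E)%E) => _ [n _ <-].
  by rewrite /b lerB // c_le.
apply/cvg_ex; exists (limn b + limn S); rewrite -cvg_shiftS.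
have -> : (fun n => a n.+1) = b + S by apply/funext => n; rewrite /b /= subrK.
exact: cvgD.
Qed.

(** The finitely many earlier terms are absorbed into the constant, one at a time. *)
Lemma geometric_bound_all (R : realFieldType) (a : nat -> R) (c rho : R) N :
  0 < rho -> 0 < c ->
  (forall n, (N <= n)%N -> a n <= c * rho ^+ n) ->
  exists2 c', 0 < c' & forall n, a n <= c' * rho ^+ n.
Proof.
move=> rho0; elim: N c => [|N IH] c c0 ac; first by exists c => // n; exact: ac.
apply: (IH (Num.max c (a N / rho ^+ N))); first by rewrite lt_max c0.
move=> n; rewrite leq_eqVlt => /predU1P[<-|/ac le1].
  by rewrite -ler_pdivrMr ?exprn_gt0 // le_max lexx orbT.
by apply: le_trans le1 _; rewrite ler_pM2r ?exprn_gt0 // le_max lexx.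
Qed.

Lemma geometric_cvg0 (R : realType) (V : normedModType R) (x : nat -> V) p
    (c rho : R) : 0 <= rho -> rho < 1 ->
  (forall n, `|x n - p| <= c * rho ^+ n) -> x @ \oo --> p.
Proof.
move=> rho0 rho1 xp; apply/cvgrPdist_le => e e0.
have : c * rho ^+ n @[n --> \oo] --> c * (0 : R).
  by apply: cvgMr; apply: cvg_expr; rewrite ger0_norm.
rewrite mulr0 => /cvgrPdist_le /(_ _ e0); apply: filterS => n.
rewrite sub0r normrN distrC => le_e; apply: le_trans (xp n) _.
exact: le_trans (ler_norm _) le_e.
Qed.

(** Here [1 - m = (9/10) (1 - mu)] and [1 + m <= (11/10) (1 + mu)], so the factors lose at most
    0.9/1.21 and 0.81/1.21, both above 1/2. *)
Lemma step_factor_half (R : realFieldType) (mu : R) : 0 < mu -> mu < 1 ->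
  let m := mu + (1 - mu) / 10 in
  (1 - mu) / (1 + mu) ^+ 2 / 2 <= (1 - m) / (1 + m) ^+ 2 /\
  (1 - mu) ^+ 2 / (1 + mu) ^+ 2 / 2 <= (1 - m) ^+ 2 / (1 + m) ^+ 2.
Proof.
move=> mu0 mu1 m.
have m1 : 0 < 1 + m by rewrite /m; lra.
have mu1' : 0 < 1 + mu by lra.
have sq : (1 + m) ^+ 2 <= (121 / 100) * (1 + mu) ^+ 2.
  have -> : (121 / 100) * (1 + mu) ^+ 2 = ((11 / 10) * (1 + mu)) ^+ 2.
    by field.
  by rewrite ler_pXn2r ?nnegrE //; rewrite /m; lra.
have E (a b : R) : 0 <= a -> (121 / 200) * a <= b ->
    a / (1 + mu) ^+ 2 / 2 <= b / (1 + m) ^+ 2.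
  move=> a0 ab; have : 0 < (1 + mu) ^+ 2 by rewrite exprn_gt0.
  have : 0 < (1 + m) ^+ 2 by rewrite exprn_gt0.
  move: sq; move: ((1 + mu) ^+ 2) ((1 + m) ^+ 2) => u v uv v0 u0.
  have -> : a / u / 2 = a * v / (2 * u) / v by field; rewrite !gt_eqF.
  rewrite ler_pM2r ?invr_gt0 // ler_pdivrMr ?mulr_gt0 //.
  have := ler_wpM2l a0 uv; nra.
split; apply: E; rewrite /m ?sqr_ge0 //; try lra.
by have := sqr_ge0 (1 - mu); nra.
Qed.

(** * Descent in one relaxed projection step *)

Section Descent.
Context (R : realType) (H : completeNormedModType R) (dot : {dot H for idfun}).
Hypothesis dot_norm : induces_norm dot.

Context (A : H -> set H) (B : H -> H) (nu L : R).
Hypotheses (A_max : maximal_monotone dot A) (nu_gt0 : 0 < nu).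
Hypothesis A_strong : strongly_monotone dot nu A.
Hypothesis B_mono : monotone_op dot (fun x => [set B x]).
Hypotheses (L_gt0 : 0 < L) (B_lip : L.-lipschitz B).

(** The squared distance drops by at least [(2 gamma - gamma^2) eta s + 2 gamma lam nu eta |y -
    p|^2], with [s] the inner product of [w - y] and [d]. The two bounds on [kappa] make this at
    least [kappa (|w - y|^2 + |y - p|^2)], hence at least [kappa / 2 |w - p|^2]. *)
Lemma relaxed_projection_descent (p w : H) (lam m gamma kappa : R) :
  let y := resolvent A lam (w - lam *: B w) in
  let d := w - y - lam *: (B w - B y) in
  let eta := if d != 0 then dot (w - y) d / `|d| ^+ 2 else 0 in
  zeros_of_sum A B p -> 0 < lam -> 0 < m < 1 -> 0 < gamma < 2 -> y <> w ->
  lam * `|B w - B y| <= m * `|w - y| -> 0 <= kappa ->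
  kappa <= (2 * gamma - gamma ^+ 2) * ((1 - m) ^+ 2 / (1 + m) ^+ 2) ->
  kappa <= 2 * gamma * (lam * nu) * ((1 - m) / (1 + m) ^+ 2) ->
  `|w - (gamma * eta) *: d - p| ^+ 2 <= (1 - kappa / 2) * `|w - p| ^+ 2.
Proof.
move=> y d eta zp lam0 /andP[m0 m1] /andP[g0 g2] yw Blip k0 k1 k2.
have [ua Aua] := resolventP dot_norm A_max (w - lam *: B w) lam0.
rewrite -/y => uaE; have [up Aup /eqP] := zp.
rewrite addr_eq0 => /eqP upE.
have N0 : 0 < `|w - y| by rewrite normr_gt0 subr_eq0; apply/eqP => /esym.
set N := `|w - y| in N0 *.
set f := lam *: (B w - B y) in d eta *.
have fN : `|f| <= m * N by rewrite normrZ gtr0_norm.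
have dN : `|d| <= (1 + m) * N.
  by apply: le_trans (ler_normB _ _) _; rewrite mulrDl mul1r lerD2l.
have dN' : (1 - m) * N <= `|d|.
  by have := lerB_dist (w - y) f; rewrite -/N -/d; lra.
have d0 : 0 < `|d| by apply: lt_le_trans dN'; rewrite mulr_gt0 // subr_gt0.
have etaE : eta = dot (w - y) d / `|d| ^+ 2 by rewrite /eta -normr_gt0 d0.
set s := dot (w - y) d in etaE.
have s_ge : (1 - m) * N ^+ 2 <= s.
  rewrite /s /d dotDr dotNr -dot_norm -/N mulrBl mul1r lerD2l lerN2.
  apply: le_trans (ler_norm _) _; apply: le_trans (dot_cauchy_schwarz dot_norm _ _) _.
  by rewrite -/N [leRHS](_ : _ = N * (m * N)) ?ler_pM2l //; ring.
have s0 : 0 < s by apply: lt_le_trans s_ge; rewrite mulr_gt0 ?subr_gt0 // exprn_gt0.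
have D0 : 0 < `|d| ^+ 2 by rewrite exprn_gt0.
have eta_s : eta * `|d| ^+ 2 = s by rewrite etaE divfK // gt_eqF.
have eta0 : 0 < eta by rewrite etaE divr_gt0.
set g := (1 - m) / (1 + m) ^+ 2 in k2.
have M0 : 0 < (1 + m) ^+ 2 by rewrite exprn_gt0 // addr_gt0.
have g_eta : g <= eta.
  rewrite /g etaE ler_pdivrMr // mulrAC ler_pdivlMr //.
  apply: (@le_trans _ _ ((1 - m) * ((1 + m) * N) ^+ 2)).
    by rewrite ler_pM2l ?subr_gt0 // ler_pXn2r ?nnegrE // mulr_ge0 ?addr_ge0 // ltW.
  by rewrite exprMn mulrCA mulrC ler_pM2r.
(* [d] is [lam] times the element [ua + B y] of [(A + B) y], and 0 lies in [(A + B) p]. *)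
have yp : lam * nu * `|y - p| ^+ 2 <= dot d (y - p).
  have := A_strong Aua Aup; rewrite upE => /(ler_wpM2l (ltW lam0)).
  rewrite opprK -dotZl scalerDr => As.
  have := monotone_ge0 B_mono y p => /(mulr_ge0 (ltW lam0)); rewrite -dotZl => Bs.
  rewrite -mulrA; apply: le_trans As _; rewrite -subr_ge0.
  apply: le_trans Bs _; rewrite -dotNl -dotDl.
  suff -> : d = lam *: ua + lam *: B y.
    by rewrite opprD addrACA subrr add0r scalerBr.
  have wy : w - y = lam *: ua + lam *: B w.
    by apply/eqP; rewrite subr_eq addrAC [_ + y]addrC uaE subrK.
  by rewrite /d /f wy scalerBr opprB [_ - lam *: B w]addrC addrA addrK.
have wp : s + lam * nu * `|y - p| ^+ 2 <= dot d (w - p).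
  have -> : w - p = (w - y) + (y - p) by rewrite addrA subrK.
  by rewrite dotDr (dotC dot d) lerD2l.
have -> : w - (gamma * eta) *: d - p = (w - p) - (gamma * eta) *: d by rewrite addrAC.
rewrite [leLHS](_ : _ = `|w - p| ^+ 2 - 2 * gamma * eta * dot d (w - p)
    + gamma ^+ 2 * eta * s); last first.
  by rewrite (sqr_norm_subZ dot_norm) -eta_s; ring.
set Y := `|y - p| ^+ 2 in yp wp *.
have Y0 : 0 <= Y by exact: sqr_ge0.
have le1 : kappa * N ^+ 2 <= (2 * gamma - gamma ^+ 2) * (eta * s).
  apply: (@le_trans _ _ ((2 * gamma - gamma ^+ 2) * (g * ((1 - m) * N ^+ 2)))).
    rewrite [leRHS](_ : _ = ((2 * gamma - gamma ^+ 2) *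
      ((1 - m) ^+ 2 / (1 + m) ^+ 2)) * N ^+ 2).
      by rewrite ler_pM2r // exprn_gt0.
    by rewrite /g; ring.
  rewrite ler_pM2l; last by nra.
  have g1 : 0 < g by rewrite /g divr_gt0 // subr_gt0.
  by rewrite ler_pM // ?ltW // mulr_gt0 ?subr_gt0 ?exprn_gt0.
have le2 : kappa * Y <= 2 * gamma * (lam * nu) * eta * Y.
  by rewrite ler_wpM2r // (le_trans k2) // ler_pM2l // !mulr_gt0.
have le3 : 2 * gamma * eta * (s + lam * nu * Y) <= 2 * gamma * eta * dot d (w - p).
  by rewrite ler_pM2l // !mulr_gt0.
have le4 : `|w - p| ^+ 2 <= 2 * (N ^+ 2 + Y).
  have -> : w - p = (w - y) + (y - p) by rewrite addrA subrK.
  rewrite /N /Y; move: (w - y) (y - p) => e h.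
  have := sqr_ge0 `|e - h|; rewrite !dot_norm !dotE (dotC dot h e); lra.
have le5 := ler_wpM2l k0 le4.
move: le1 le2 le3 le5; rewrite !mulrDr.
move: (N ^+ 2) (`|w - p| ^+ 2) (dot d (w - p)) => n2 W D.
lra.
Qed.

End Descent.

(** The lower bound comes from [2 gamma - gamma^2 <= 1]; it later forces [theta <= 1/3]. *)
Lemma tau_rate_bounds (R : realType) (gamma mu nu L lam1 : R) :
  0 < gamma < 2 -> 0 < mu < 1 -> 0 < nu -> 0 < L -> 0 < lam1 ->
  3 / 4 <= tau_rate gamma mu nu L lam1 < 1.
Proof.
move=> /andP[g0 g2] /andP[mu0 mu1] nu0 L0 l0; rewrite /tau_rate.
have M0 : 0 < (1 + mu) ^+ 2 by rewrite exprn_gt0 // addr_gt0.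
have G0 : 0 < 2 * gamma - gamma ^+ 2 by nra.
set K := Num.min _ _.
have K0 : 0 < K.
  rewrite lt_min; apply/andP; split.
    by rewrite divr_gt0 // mulr_gt0 // exprn_gt0 // subr_gt0.
  by rewrite !mulr_gt0 ?invr_gt0 ?subr_gt0 // lt_min l0 divr_gt0.
have K1 : K <= 1.
  rewrite ge_min; apply/orP; left; rewrite ler_pdivrMr // mul1r.
  have : (1 - mu) ^+ 2 <= (1 + mu) ^+ 2 by nra.
  have : 2 * gamma - gamma ^+ 2 <= 1 by have := sqr_ge0 (gamma - 1); nra.
  have := sqr_ge0 (1 - mu).
  by move: (_ - gamma ^+ 2) ((1 - mu) ^+ 2) ((1 + mu) ^+ 2) => a b c; nra.
by apply/andP; split; lra.
Qed.

(** * Step sizes and eventual contraction along a run *)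

Section Run.
Context (R : realType) (H : completeNormedModType R) (dot : {dot H for idfun}).
Hypothesis dot_norm : induces_norm dot.
Context (A : H -> set H) (B : H -> H) (nu L gamma mu lam1 alpha theta : R).
Hypotheses (A_max : maximal_monotone dot A) (nu_gt0 : 0 < nu).
Hypothesis A_strong : strongly_monotone dot nu A.
Hypothesis B_mono : monotone_op dot (fun x => [set B x]).
Hypotheses (L_gt0 : 0 < L) (B_lip : L.-lipschitz B).
Hypotheses (gamma_gt0 : 0 < gamma) (gamma_lt2 : gamma < 2).
Hypotheses (mu_gt0 : 0 < mu) (mu_lt1 : mu < 1) (lam1_gt0 : 0 < lam1).
Context (xi : nat -> R) (x w y d u : nat -> H) (eta lam : nat -> R).
Hypothesis xi_ge0 : forall n, (0 < n)%N -> 0 <= xi n.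
Hypothesis xi_sum : (\sum_(1 <= n <oo) (xi n)%:E < +oo)%E.
Hypothesis run :
  IPCMAS2_run dot A B gamma mu lam1 alpha theta xi x w y d u eta lam.

Lemma step_size_succ_le n : (0 < n)%N -> lam n.+1 <= lam n + xi n.
Proof.
by move=> n0; rewrite (run_lam run n0); case: ifP => // _; rewrite ge_min lexx orbT.
Qed.

(** The update controls the next step size against the current points; convergence of [lam] is what
    transfers the bound to [lam n]. *)
Lemma step_size_succ_lipschitz n : (0 < n)%N ->
  lam n.+1 * `|B (w n) - B (y n)| <= mu * `|w n - y n|.
Proof.
move=> n0; rewrite (run_lam run n0); case: ifPn => [ne|/negPn/eqP ->].
  by rewrite -ler_pdivlMr ?normr_gt0 ?subr_eq0 // ge_min lexx.
by rewrite subrr normr0 mulr0 mulr_ge0 // ltW.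
Qed.

Lemma step_size_ge n : (0 < n)%N -> Num.min lam1 (mu / L) <= lam n.
Proof.
elim: n => [//|[|n] IH] _; first by rewrite (run_lam1 run) ge_min lexx.
have le_xi : Num.min lam1 (mu / L) <= lam n.+1 + xi n.+1.
  by apply: le_trans (IH isT) _; rewrite lerDl xi_ge0.
rewrite (run_lam run (ltn0Sn n)); case: ifP => // ne.
rewrite le_min le_xi andbT; apply: (@le_trans _ _ (mu / L)).
  by rewrite ge_min lexx orbT.
rewrite ler_pdivlMr ?normr_gt0 ?subr_eq0 // -mulrA ler_pM2l // ler_pdivrMl //.
exact: lipschitz_le.
Qed.

Lemma step_size_eventually_lipschitz m : mu < m ->
  \forall n \near \oo, lam n * `|B (w n) - B (y n)| <= m * `|w n - y n|.
Proof.
move=> mu_m; set l := Num.min lam1 (mu / L).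
have l0 : 0 < l by rewrite lt_min lam1_gt0 divr_gt0.
(* As [l <= lam n.+1], a decrease smaller than this tolerance gives [lam n <= m / mu * lam n.+1]. *)
have e0 : 0 < (m - mu) / mu * l by rewrite mulr_gt0 // divr_gt0 // subr_gt0.
have /cvg_ex[/= a lam_a] : cvgn lam.
  exact: quasi_nonincreasing_cvg xi_ge0 xi_sum step_size_succ_le step_size_ge.
have dlam : lam n - lam n.+1 @[n --> \oo] --> a - a.
  by apply: cvgB => //; rewrite cvg_shiftS.
move: dlam; rewrite subrr => /cvgrPdist_lt /(_ _ e0) near1.
near=> n; have n0 : (0 < n)%N by near: n; exists 1%N.
have : `|0 - (lam n - lam n.+1)| < (m - mu) / mu * l by near: n.
rewrite sub0r normrN => /(le_lt_trans (ler_norm _)) lt1.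
have ratio : lam n <= m / mu * lam n.+1.
  have : (m - mu) / mu * l <= (m - mu) / mu * lam n.+1.
    by rewrite ler_pM2l ?step_size_ge // divr_gt0 // subr_gt0.
  by rewrite mulrBl divff ?gt_eqF //; move: lt1; rewrite mulrBl divff ?gt_eqF //; lra.
apply: (@le_trans _ _ (m / mu * lam n.+1 * `|B (w n) - B (y n)|)).
  by rewrite ler_wpM2r.
rewrite -mulrA; apply: (@le_trans _ _ (m / mu * (mu * `|w n - y n|))).
  by rewrite ler_pM2l ?step_size_succ_lipschitz // divr_gt0 // (lt_trans mu_gt0).
by rewrite mulrA divfK ?gt_eqF.
Unshelve. all: by end_near.
Qed.

(* With [mu] itself the factor would be [1 - K / 2] for the minimum [K] in
   [tau_rate]; the gap to [tau = 1 - K / 4] absorbs replacing [mu] by [m]. *)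
Lemma eventually_contraction p : zeros_of_sum A B p ->
  \forall n \near \oo, `|u n - p| ^+ 2 <=
    tau_rate gamma mu nu L lam1 * `|w n - p| ^+ 2.
Proof.
move=> zp; pose m := mu + (1 - mu) / 10.
have mu_m : mu < m by move: mu_lt1; rewrite /m; lra.
have m01 : 0 < m < 1 by move: mu_gt0 mu_lt1; rewrite /m => *; apply/andP; split; lra.
have [half1 half2] := step_factor_half mu_gt0 mu_lt1.
rewrite -/m in half1 half2.
have lip := step_size_eventually_lipschitz mu_m.
have := tau_rate_bounds (introT andP (conj gamma_gt0 gamma_lt2))
  (introT andP (conj mu_gt0 mu_lt1)) nu_gt0 L_gt0 lam1_gt0.
rewrite {1 2}/tau_rate; set K := Num.min _ _ => /andP[_ K0].
near=> n; have n0 : (0 < n)%N by near: n; exists 1%N.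
have lam_n : 0 < lam n.
  by apply: lt_le_trans (step_size_ge n0); rewrite lt_min lam1_gt0 divr_gt0.
have G0 : 0 < 2 * gamma - gamma ^+ 2 by move: gamma_gt0 gamma_lt2; nra.
rewrite (_ : tau_rate _ _ _ _ _ = 1 - (K / 2) / 2); last first.
  by rewrite /tau_rate -/K; lra.
rewrite (run_u run n0) (run_eta run n0) (run_d run n0) (run_y run n0).
apply: (relaxed_projection_descent dot_norm A_max nu_gt0 A_strong B_mono
  (lam := lam n) (m := m) (w := w n)) => //.
- by rewrite gamma_gt0.
- by rewrite -(run_y run n0); exact: run_continues run n n0.
- by rewrite -(run_y run n0); near: n.
- by lra.
- apply: (@le_trans _ _ ((2 * gamma - gamma ^+ 2) *
    ((1 - mu) ^+ 2 / (1 + mu) ^+ 2 / 2))); last by rewrite ler_pM2l.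
  by rewrite mulrA ler_pM2r // mulrA ge_min lexx.
- apply: (@le_trans _ _ (2 * gamma * (lam n * nu) *
    ((1 - mu) / (1 + mu) ^+ 2 / 2))); last first.
    by rewrite ler_pM2l // !mulr_gt0.
  rewrite [leRHS]mulrA ler_pM2r //.
  apply: (@le_trans _ _ (2 * nu * gamma * ((1 - mu) / (1 + mu) ^+ 2) *
    Num.min lam1 (mu / L))); first by rewrite ge_min lexx orbT.
  rewrite [leRHS](_ : _ = 2 * nu * gamma * ((1 - mu) / (1 + mu) ^+ 2) * lam n).
    rewrite ler_wpM2l ?step_size_ge // !mulr_ge0 ?invr_ge0 ?sqr_ge0 ?subr_ge0 //;
      exact: ltW.
  by ring.
Unshelve. all: by end_near.
Qed.

(** * Lyapunov function and R-linear rate *)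

Hypotheses (alpha_gt0 : 0 < alpha) (alpha_lt : alpha < 3^-1).
Hypothesis theta_ge0 : 0 <= theta.
Hypothesis theta_lt : theta < (tau_rate gamma mu nu L lam1)^-1 - 1.

(** The weight is dictated by the convexity identity: as [x n - u n] is [(x n - x n.+1) / alpha],
    its negative term is exactly this multiple of the new squared increment and cancels it. *)
Let V p n : R :=
  `|x n - p| ^+ 2 + (1 - alpha) / alpha * `|x n - x n.-1| ^+ 2.

Lemma lyapunov_contraction p : zeros_of_sum A B p ->
  exists2 r, 0 < r < 1 & \forall n \near \oo, V p n.+1 <= r * V p n.
Proof.
move: alpha_gt0 alpha_lt theta_ge0 theta_lt => al0 al13 th0.
set tau := tau_rate _ _ _ _ _ => th_lt zp.
have /andP[tau34 tau1] : 3 / 4 <= tau < 1.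
  by apply: tau_rate_bounds => //; rewrite ?gamma_gt0 ?mu_gt0.
have tau0 : 0 < tau by lra.
have tt1 : tau * (1 + theta) < 1.
  by rewrite -ltr_pdivlMl // mulr1 -ltrBrDl.
have th13 : theta <= 1 / 3 by nra.
set r := 1 - alpha * (1 - tau * (1 + theta)).
have r23 : 2 / 3 <= r by rewrite /r; nra.
exists r; first by apply/andP; split; [lra|rewrite /r; nra].
set k := (1 - alpha) / alpha.
have k2 : 2 <= k by rewrite /k ler_pdivlMr //; lra.
have contr := eventually_contraction zp.
near=> n; have n0 : (0 < n)%N by near: n; exists 1%N.
have : `|u n - p| ^+ 2 <= tau * `|w n - p| ^+ 2 by near: n.
have -> : w n - p = (x n - p) + theta *: ((x n - p) - (x n.-1 - p)).
  by rewrite (run_w run n0) opprB addrA subrK addrAC.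
rewrite (sqr_norm_extrapolation dot_norm) opprB addrA subrK => le_u.
have x_p : x n.+1 - p = (1 - alpha) *: (x n - p) + alpha *: (u n - p).
  by rewrite (run_x run n0) !scalerBr addrACA -opprD -scalerDl subrK scale1r.
have x_x : x n - u n = alpha^-1 *: (x n - x n.+1).
  have -> : x n - x n.+1 = alpha *: (x n - u n).
    rewrite (run_x run n0) scalerBl scale1r opprD opprB addrA [_ + (_ - _)]addrC.
    by rewrite subrK scalerBr.
  by rewrite scalerA mulVf ?gt_eqF // scale1r.
rewrite /V -pred_Sn -/k x_p (sqr_norm_convex dot_norm).
rewrite opprB addrA subrK x_x normrZ exprMn ger0_norm ?invr_ge0 ?(ltW al0) //.
rewrite (distrC (x n) (x n.+1)).
have -> : alpha * (1 - alpha) * (alpha^-1 ^+ 2 * `|x n.+1 - x n| ^+ 2) =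
    k * `|x n.+1 - x n| ^+ 2 by rewrite /k; field; rewrite gt_eqF.
have a1 : 0 <= `|x n - p| ^+ 2 by exact: sqr_ge0.
have a2 : 0 <= `|x n.-1 - p| ^+ 2 by exact: sqr_ge0.
have a3 : 0 <= `|x n - x n.-1| ^+ 2 by exact: sqr_ge0.
move: le_u a1 a2 a3; rewrite -/k.
move: (`|x n - p| ^+ 2) (`|x n.-1 - p| ^+ 2) (`|x n - x n.-1| ^+ 2)
  (`|u n - p| ^+ 2) (k * `|x n.+1 - x n| ^+ 2) => a b e v z le_v a0 b0 e0.
have le1 : alpha * v <=
    alpha * (tau * ((1 + theta) * a - theta * b + theta * (1 + theta) * e)).
  by rewrite ler_pM2l.
(* The left coefficient is at most 1, while [r >= 2/3] and [k >= 2] give [r k >= 4/3]. *)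
have le2 : alpha * (tau * (theta * (1 + theta))) * e <= r * k * e.
  have at0 : 0 <= alpha * theta by rewrite mulr_ge0 // ltW.
  have at1 : alpha * theta <= 1 by nra.
  rewrite ler_wpM2r //; apply: (@le_trans _ _ 1); last by nra.
  rewrite [leLHS](_ : _ = alpha * theta * (tau * (1 + theta))); last by ring.
  by rewrite (le_trans _ at1) // ler_piMr // ltW.
have le3 : 0 <= alpha * tau * theta * b by rewrite !mulr_ge0 // ltW.
move: le1 le2 le3; rewrite /r; lra.
Unshelve. all: by end_near.
Qed.

Lemma run_r_linear p : zeros_of_sum A B p ->
  exists c rho : R, [/\ 0 < c, 0 <= rho, rho < 1 &
    forall n, `|x n - p| <= c * rho ^+ n].
Proof.
move=> zp; have [r /andP[r0 r1] [N _ VN]] := lyapunov_contraction zp.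
have V0 n : 0 <= V p n.
  rewrite addr_ge0 ?mulr_ge0 ?invr_ge0 ?sqr_ge0 ?(ltW alpha_gt0) //.
  by rewrite subr_ge0 (le_trans (ltW alpha_lt)) // invf_le1 // ler1n.
have rN n : (N <= n)%N -> V p n <= (V p N / r ^+ N) * r ^+ n.
  elim: n => [|n IH]; rewrite leq_eqVlt => /predU1P[NE|//].
  - by rewrite -NE divfK // expf_neq0 ?gt_eqF.
  - by rewrite -NE divfK // expf_neq0 ?gt_eqF.
  rewrite ltnS => Nn; apply: le_trans (VN n Nn) _.
  by rewrite exprS mulrCA ler_pM2l // IH.
(* [V] dominates the squared distance, hence the square root. *)
pose rho := Num.sqrt r.
have rho0 : 0 < rho by rewrite sqrtr_gt0.
have rho1 : rho < 1 by rewrite -sqrtr1 ltr_sqrt.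
(* The added 1 keeps [c] positive even if [V p N = 0]. *)
pose c := Num.sqrt (V p N / r ^+ N) + 1.
have c0 : 0 < c by rewrite ltr_wpDl ?sqrtr_ge0.
have bound n : (N <= n)%N -> `|x n - p| <= c * rho ^+ n.
  move=> /rN Vn; apply: (@le_trans _ _ (Num.sqrt (V p N / r ^+ N) * rho ^+ n)).
    rewrite -(@ler_pXn2r _ 2) ?nnegrE ?mulr_ge0 ?exprn_ge0 ?sqrtr_ge0 //.
    rewrite exprMn sqr_sqrtr ?divr_ge0 ?exprn_ge0 ?(ltW r0) //.
    rewrite -exprM mulnC exprM sqr_sqrtr ?(ltW r0) //.
    apply: le_trans Vn; rewrite lerDl mulr_ge0 ?sqr_ge0 // divr_ge0 ?ltW //.
    by rewrite subr_gt0 (lt_trans alpha_lt) // invf_lt1 // ltr1n.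
  by rewrite ler_pM2r ?exprn_gt0 // lerDl.
have [c' c'0 c'_bound] := geometric_bound_all rho0 c0 bound.
by exists c', rho; rewrite (ltW rho0).
Qed.

End Run.

(** * Strong convergence, with a limit chosen before the run *)

Theorem theorem12 (R : realType) (H : completeNormedModType R)
    (dot : {dot H for idfun}) (dot_norm : induces_norm dot)
    (A : H -> set H) (B : H -> H) (nu L gamma mu lam1 alpha theta : R)
    (A_max : maximal_monotone dot A)
    (nu_gt0 : 0 < nu) (A_strong : strongly_monotone dot nu A)
    (B_mono : monotone_op dot (fun x => [set B x]))
    (L_gt0 : 0 < L) (B_lip : L.-lipschitz B)
    (gamma_gt0 : 0 < gamma) (gamma_lt2 : gamma < 2)
    (mu_gt0 : 0 < mu) (mu_lt1 : mu < 1)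
    (lam1_gt0 : 0 < lam1)
    (alpha_gt0 : 0 < alpha) (alpha_lt : alpha < 3^-1)
    (theta_ge0 : 0 <= theta)
    (theta_lt : theta < (tau_rate gamma mu nu L lam1)^-1 - 1) :
  exists xstar : H,
    zeros_of_sum A B = [set xstar] /\
    forall (xi : nat -> R) (x w y d u : nat -> H) (eta lam : nat -> R),
      (forall n, (0 < n)%N -> 0 <= xi n) ->
      (\sum_(1 <= n <oo) (xi n)%:E < +oo)%E ->
      IPCMAS2_run dot A B gamma mu lam1 alpha theta xi x w y d u eta lam ->
      x @ \oo --> xstar /\
      exists c rho : R, [/\ 0 < c, 0 <= rho, rho < 1 &
        forall n, `|x n - xstar| <= c * rho ^+ n].
Proof.
have [p zE] :=
  zeros_of_sum_unique dot_norm A_max nu_gt0 A_strong B_mono L_gt0 B_lip.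
exists p; split=> // xi x w y d u eta lam xi_ge0 xi_sum run.
have zp : zeros_of_sum A B p by rewrite zE.
have [c [rho [c0 rho0 rho1 bound]]] := run_r_linear dot_norm A_max nu_gt0
  A_strong B_mono L_gt0 B_lip gamma_gt0 gamma_lt2 mu_gt0 mu_lt1 lam1_gt0
  xi_ge0 xi_sum run alpha_gt0 alpha_lt theta_ge0 theta_lt zp.
by split; [exact: geometric_cvg0 rho0 rho1 bound|exists c, rho].
Qed.
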